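(* Let $m\ge n\ge2$ be integers with $(m,n)\neq(2,2)$, let $G_{m,n}=\langle x,y \mid x^m=y^n\rangle$, and let $<_D$ be the Dehornoy-like ordering of $G_{m,n}$ defined by the ordered generating set $\mathcal{S}=\{s_1=xyx^{-m+1},\ s_2=x^{m-1}y^{-1}\}$. Let $E=(0;-1111\cdots)$ and $F=(0;+1111\cdots)$ in $\widetilde{E}(T)$. Then the left ordering $<_{\{E,F\}}$ of $G_{m,n}$ defined by the sequence $\{E,F\}$ and the standard action is identical with $<_D$.
   Context: Dehornoy-like ordering: $<_D$ is the left ordering of $G_{m,n}$ (total order invariant under left multiplication) whose positive cone $\{g: 1<_D g\}$ is the set of elements represented either by a word on $s_1,s_2^{\pm1}$ containing at least one $s_1$ and no $s_1^{-1}$, or by $s_2^k$ with $k\ge1$. It is known that this set is indeed the positive cone of a left ordering. Standard action: $G_{m,n}$ is a central extension of $\mathbb{Z}_m*\mathbb{Z}_n$ by $\mathbb{Z}$, and the action of $\mathbb{Z}_m*\mathbb{Z}_n$ on its (planar) Bass–Serre tree $T$ extends to an action on the circle at infinity, which lifts to a faithful orientation-preserving action of $G_{m,n}$ on $\mathbb{R}$, the standard action. It preserves the lift $\widetilde{E}(T)\subset\mathbb{R}$ of the set of ends of $T$, and its restriction to $\widetilde{E}(T)$ is described explicitly as follows. The points of $\widetilde{E}(T)$ are the sequences $(N;\epsilon\, l_1l_2l_3\cdots)$ with $N\in\mathbb{Z}$, $\epsilon\in\{+,-\}$, where if $\epsilon=+$ then $l_j\in\{1,\dots,m-1\}$ for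 $j$ odd and $l_j\in\{1,\dots,n-1\}$ for $j$ even, and if $\epsilon=-$ then $l_j\in\{1,\dots,n-1\}$ for $j$ odd and $l_j\in\{1,\dots,m-1\}$ for $j$ even. The order $<_{\mathbb{R}}$ on $\widetilde{E}(T)$ is lexicographic (with $-<+$). $G_{m,n}$ acts on the left by order-preserving bijections: $x:(N;+i\cdots)\mapsto(N;+(i+1)\cdots)$ if $i\neq m-1$; $(N;+(m-1)\cdots)\mapsto(N+1;-\cdots)$; $(N;-i\cdots)\mapsto(N;+1i\cdots)$; $y:(N;+i\cdots)\mapsto(N+1;-1i\cdots)$; $(N;-i\cdots)\mapsto(N;-(i+1)\cdots)$ if $i\neq n-1$; $(N;-(n-1)\cdots)\mapsto(N;+\cdots)$. (Dots denote the unchanged remaining letters.) Ordering defined by $\{E,F\}$: $g<_{\{E,F\}}g'$ iff $g(E)<_{\mathbb{R}}g'(E)$, or $g(E)=g'(E)$ and $g(F)<_{\mathbb{R}}g'(F)$. *)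

(* Defs.v *)
From HB Require Import structures.
From mathcomp Require Import all_boot all_order all_algebra.
From mathcomp Require Import boolp zify.

Set Implicit Arguments.
Unset Strict Implicit.
Unset Printing Implicit Defensive.

Import Order.TTheory GRing.Theory.

Local Open Scope quotient_scope.
Local Open Scope group_scope.

(* A letter (i, e) is the first generator if i = false, the second one if
   i = true, inverted if e = true. *)
Definition letter : Type := (bool * bool)%type.
Definition word : Type := seq letter.

Definition linv (l : letter) : letter := (l.1, ~~ l.2).
Definition winv (w : word) : word := rev (map linv w).

Definition eval_letter (G : groupType) (a b : G) (l : letter) : G :=
  let c := if l.1 then b else a in if l.2 then c^-1 else c.

Definition eval (G : groupType) (a b : G) (w : word) : G :=
  foldr (fun l g => eval_letter a b l * g) 1 w.

Notation lx := ((false, false) : letter).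
Notation ly := ((true, false) : letter).

Section Group.
Variables m n : nat.

Inductive weq : word -> word -> Prop :=
| weq_refl u : weq u u
| weq_sym u v : weq u v -> weq v u
| weq_trans u v w : weq u v -> weq v w -> weq u w
| weq_cancel u l v : weq (u ++ l :: linv l :: v) (u ++ v)
| weq_rel u v : weq (u ++ nseq m lx ++ v) (u ++ nseq n ly ++ v).

Definition weqb (u v : word) : bool := `[< weq u v >].

Lemma weqb_refl : reflexive weqb.
Proof. by move=> u; apply/asboolP; exact: weq_refl. Qed.

Lemma weqb_sym : symmetric weqb.
Proof. by move=> u v; apply/asboolP/asboolP; exact: weq_sym. Qed.

Lemma weqb_trans : transitive weqb.
Proof.
move=> v u w /asboolP uv /asboolP vw; apply/asboolP; exact: weq_trans uv vw.
Qed.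

Canonical weqb_equiv := EquivRel weqb weqb_refl weqb_sym weqb_trans.

(* The presented group <x, y | x^m = y^n>, with x the first generator and y
   the second one. *)
Definition Gmn : Type := {eq_quot weqb}.
HB.instance Definition _ := Choice.on Gmn.
HB.instance Definition _ := Quotient.on Gmn.
HB.instance Definition _ := EqQuotient.on Gmn.

Lemma pi_weq (u v : word) : weq u v -> \pi_Gmn u = \pi_Gmn v.
Proof. by move=> uv; apply/eqmodP/asboolP. Qed.

Lemma weq_repr (u : word) : weq (repr (\pi_Gmn u)) u.
Proof. by apply/asboolP; rewrite -[`[< _ >]]/(weqb _ _) -eqmodE reprK. Qed.

Lemma weq_cat (u1 u2 v1 v2 : word) :
  weq u1 u2 -> weq v1 v2 -> weq (u1 ++ v1) (u2 ++ v2).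
Proof.
move=> u12 v12; apply: (@weq_trans _ (u2 ++ v1)).
  elim: u12 {v12} => [u|u v _|u v w _ uv _ vw|u l v|u v].
  - exact: weq_refl.
  - exact: weq_sym.
  - exact: weq_trans uv vw.
  - by rewrite -!catA; exact: weq_cancel.
  - by rewrite -!catA; exact: weq_rel.
elim: v12 {u12 u1} => [u|u v _|u v w _ uv _ vw|u l v|u v].
- exact: weq_refl.
- exact: weq_sym.
- exact: weq_trans uv vw.
- by rewrite 2!catA; exact: weq_cancel.
- by rewrite [u2 ++ _]catA [u2 ++ (u ++ _)]catA; exact: weq_rel.
Qed.

Lemma linvK : involutive linv.
Proof. by case=> i e; rewrite /linv /= negbK. Qed.

Lemma winvK : involutive winv.
Proof. by move=> w; rewrite /winv map_rev revK (mapK linvK). Qed.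

Lemma weq_winvr (w : word) : weq (w ++ winv w) [::].
Proof.
elim: w => [|l w IHw]; first exact: weq_refl.
rewrite /winv /= rev_cons -cats1 -/(winv w) catA.
apply: (@weq_trans _ [:: l; linv l]); last exact: (weq_cancel [::] l [::]).
apply: (@weq_cat [:: l] [:: l] _ [:: linv l]); first exact: weq_refl.
by apply: (@weq_cat _ [::] [:: linv l] [:: linv l]) => //; exact: weq_refl.
Qed.

Lemma weq_winvl (w : word) : weq (winv w ++ w) [::].
Proof. by rewrite -{2}[w]winvK; exact: weq_winvr. Qed.

Lemma weq_winv (u v : word) : weq u v -> weq (winv u) (winv v).
Proof.
move=> uv; apply: (@weq_trans _ (winv u ++ (v ++ winv v))).
  rewrite -{1}[winv u]cats0; apply: weq_cat; first exact: weq_refl.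
  by apply: weq_sym; exact: weq_winvr.
rewrite catA -[winv v in X in weq _ X]cat0s.
apply: weq_cat; last exact: weq_refl.
apply: (weq_trans _ (weq_winvl u)).
by apply: weq_cat; [exact: weq_refl | exact: weq_sym].
Qed.

Definition Gmul (g h : Gmn) : Gmn := \pi_Gmn (repr g ++ repr h).
Definition Gone : Gmn := \pi_Gmn [::].
Definition Ginv (g : Gmn) : Gmn := \pi_Gmn (winv (repr g)).

Lemma GmulA : associative Gmul.
Proof.
move=> f g h; apply: pi_weq.
apply: (@weq_trans _ (repr f ++ repr g ++ repr h)).
  by apply: weq_cat; [exact: weq_refl | exact: weq_repr].
rewrite catA; apply: weq_sym.
by apply: weq_cat; [exact: weq_repr | exact: weq_refl].
Qed.

Lemma Gmul1g : left_id Gone Gmul.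
Proof.
move=> g; rewrite -[RHS]reprK; apply: pi_weq.
rewrite -[X in weq _ X]cat0s.
by apply: weq_cat; [exact: weq_repr | exact: weq_refl].
Qed.

Lemma Gmulg1 : right_id Gone Gmul.
Proof.
move=> g; rewrite -[RHS]reprK; apply: pi_weq.
rewrite -[X in weq _ X]cats0.
by apply: weq_cat; [exact: weq_refl | exact: weq_repr].
Qed.

Lemma GmulVg : left_inverse Gone Ginv Gmul.
Proof.
move=> g; apply: pi_weq; apply: (weq_trans _ (weq_winvl (repr g))).
by apply: weq_cat; [exact: weq_repr | exact: weq_refl].
Qed.

Lemma GmulgV : right_inverse Gone Ginv Gmul.
Proof.
move=> g; apply: pi_weq; apply: (weq_trans _ (weq_winvr (repr g))).
by apply: weq_cat; [exact: weq_refl | exact: weq_repr].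
Qed.

HB.instance Definition _ :=
  isGroup.Build Gmn GmulA Gmul1g Gmulg1 GmulVg GmulgV.

Definition gx : Gmn := \pi_Gmn [:: lx].
Definition gy : Gmn := \pi_Gmn [:: ly].

End Group.

Definition left_ordering (G : groupType) (lt : G -> G -> Prop) : Prop :=
  [/\ forall g, ~ lt g g,
      forall f g h, lt f g -> lt g h -> lt f h,
      forall g h, [\/ lt g h, g = h | lt h g]
    & forall f g h, lt g h -> lt (f * g) (f * h)].

Section DehornoyLike.
Variables (G : groupType) (a b : G).

(* (false, false) is the letter a and (false, true) is a^-1; w may contain b and
   b^-1 freely. *)
Definition dehornoy_positive (g : G) : Prop :=
  (exists w : word, [/\ (false, false) \in w, (false, true) \notin w
                      & eval a b w = g])
  \/ (exists2 k : nat, (1 <= k)%N & g = b ^+ k).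

Definition dehornoy_lt (g h : G) : Prop := dehornoy_positive (g^-1 * h).

End DehornoyLike.

Definition s1 (m n : nat) : Gmn m n := gx m n * gy m n * gx m n ^- (m - 1)%N.
Definition s2 (m n : nat) : Gmn m n := gx m n ^+ (m - 1)%N * (gy m n)^-1.

Local Close Scope group_scope.

(* (N, eps, u) is the point (N; eps l_1 l_2 l_3 ...) with l_(j+1) = u j, where
   the sign + is true and the sign - is false. *)
Definition raw_end : Type := (int * bool * (nat -> nat))%type.

(* Strict upper bound on u j: since j counts from 0, the letters l_j with j odd
   are at the even indices. *)
Definition letter_bound (m n : nat) (eps : bool) (j : nat) : nat :=
  if eps (+) odd j then m else n.

Definition is_end (m n : nat) (p : raw_end) : Prop :=
  forall j, 0 < p.2 j < letter_bound m n p.1.2 j.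

Record lift_end (m n : nat) := LiftEnd {
  end_val :> raw_end;
  end_valP : is_end m n end_val }.

Definition scons (a : nat) (u : nat -> nat) : nat -> nat :=
  fun j => if j is k.+1 then u k else a.
Definition stail (u : nat -> nat) : nat -> nat := fun j => u j.+1.

Definition x_raw (m : nat) (p : raw_end) : raw_end :=
  let: (N, eps, u) := p in
  if eps then
    if u 0 == m - 1 then ((N + 1)%R, false, stail u)
    else (N, true, scons (u 0 + 1) (stail u))
  else (N, true, scons 1 u).

Definition y_raw (n : nat) (p : raw_end) : raw_end :=
  let: (N, eps, u) := p in
  if eps then ((N + 1)%R, false, scons 1 u)
  else
    if u 0 == n - 1 then (N, true, stail u)
    else (N, false, scons (u 0 + 1) (stail u)).

Definition xinv_raw (m : nat) (p : raw_end) : raw_end :=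
  let: (N, eps, u) := p in
  if eps then
    if u 0 == 1 then (N, false, stail u)
    else (N, true, scons (u 0 - 1) (stail u))
  else ((N - 1)%R, true, scons (m - 1) u).

Definition yinv_raw (n : nat) (p : raw_end) : raw_end :=
  let: (N, eps, u) := p in
  if eps then (N, false, scons (n - 1) u)
  else
    if u 0 == 1 then ((N - 1)%R, true, stail u)
    else (N, false, scons (u 0 - 1) (stail u)).

Section Action.
Variables m n : nat.
Implicit Types (p : raw_end) (e : lift_end m n).

Lemma lift_end_inj e e' : end_val e = end_val e' -> e = e'.
Proof.
case: e e' => [p pP] [q qP] /= pq; rewrite -{q}pq in qP *.
by rewrite (Prop_irrelevance pP qP).
Qed.

Lemma letter_boundS eps j :
  letter_bound m n eps j.+1 = letter_bound m n (~~ eps) j.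
Proof. by rewrite /letter_bound /= addbN addNb. Qed.

Lemma end_gt1 p : is_end m n p -> (1 < m) && (1 < n).
Proof.
move=> pP; have := pP 0; have := pP 1; rewrite /letter_bound /=.
by case: p.1.2 => /= /andP[/leq_ltn_trans lt1 {}/lt1 ->]
                     /andP[/leq_ltn_trans lt0 {}/lt0 ->].
Qed.

Lemma x_rawP p : is_end m n p -> is_end m n (x_raw m p).
Proof.
move=> pP; have /andP[m1 n1] := end_gt1 pP.
case: p pP => [[N [] u]] uP /=; have := uP 0; rewrite /letter_bound /=.
  case: eqP => [_ _|/eqP ne /andP[_ ltm]] j.
    by have := uP j.+1; rewrite letter_boundS.
  case: j => [|j]; last exact: (uP j.+1).
  by rewrite /letter_bound /=; lia.
move=> _ [|j]; first by rewrite /letter_bound /=.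
by have := uP j; rewrite letter_boundS.
Qed.

Lemma y_rawP p : is_end m n p -> is_end m n (y_raw n p).
Proof.
move=> pP; have /andP[m1 n1] := end_gt1 pP.
case: p pP => [[N [] u]] uP /=; have := uP 0; rewrite /letter_bound /=.
  move=> _ [|j]; first by rewrite /letter_bound /=.
  by have := uP j; rewrite letter_boundS.
case: eqP => [_ _|/eqP ne /andP[_ ltm]] j.
  by have := uP j.+1; rewrite letter_boundS.
case: j => [|j]; last exact: (uP j.+1).
by rewrite /letter_bound /=; lia.
Qed.

Lemma xinv_rawP p : is_end m n p -> is_end m n (xinv_raw m p).
Proof.
move=> pP; have /andP[m1 n1] := end_gt1 pP.
case: p pP => [[N [] u]] uP /=; have := uP 0; rewrite /letter_bound /=.
  case: eqP => [_ _|/eqP ne /andP[gt0 ltm]] j.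
    by have := uP j.+1; rewrite letter_boundS.
  case: j => [|j]; last exact: (uP j.+1).
  by rewrite /letter_bound /=; lia.
move=> _ [|j]; first by rewrite /letter_bound /=; lia.
by have := uP j; rewrite letter_boundS.
Qed.

Lemma yinv_rawP p : is_end m n p -> is_end m n (yinv_raw n p).
Proof.
move=> pP; have /andP[m1 n1] := end_gt1 pP.
case: p pP => [[N [] u]] uP /=; have := uP 0; rewrite /letter_bound /=.
  move=> _ [|j]; first by rewrite /letter_bound /=; lia.
  by have := uP j; rewrite letter_boundS.
case: eqP => [_ _|/eqP ne /andP[gt0 ltm]] j.
  by have := uP j.+1; rewrite letter_boundS.
case: j => [|j]; last exact: (uP j.+1).
by rewrite /letter_bound /=; lia.
Qed.

Definition x_map e : lift_end m n := LiftEnd (x_rawP (end_valP e)).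
Definition y_map e : lift_end m n := LiftEnd (y_rawP (end_valP e)).
Definition xinv_map e : lift_end m n := LiftEnd (xinv_rawP (end_valP e)).
Definition yinv_map e : lift_end m n := LiftEnd (yinv_rawP (end_valP e)).

Lemma scons_stail a (u : nat -> nat) : u 0 = a -> scons a (stail u) = u.
Proof. by move=> <-; apply/funext => -[]. Qed.

Lemma stail_scons a (u : nat -> nat) : stail (scons a u) = u.
Proof. by []. Qed.

Lemma x_mapK : cancel x_map xinv_map.
Proof.
move=> e; apply: lift_end_inj; move: (end_valP e) => /=.
case: (end_val e) => [[N []] u] uP /=; have := uP 0; rewrite /letter_bound //=.
case: eqP => [u0 _|u0 /andP[gt0 _]] /=; first by rewrite addrK scons_stail.
rewrite ifF; last by apply/eqP; lia.
by rewrite stail_scons scons_stail //; lia.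
Qed.

Lemma xinv_mapK : cancel xinv_map x_map.
Proof.
move=> e; apply: lift_end_inj; move: (end_valP e) => /=.
case: (end_val e) => [[N []] u] uP /=; have := uP 0; rewrite /letter_bound /=.
  case: eqP => [u0 _|u0 /andP[gt0 ltm]] /=; first by rewrite scons_stail.
  rewrite ifF; last by apply/eqP; lia.
  by rewrite stail_scons scons_stail //; lia.
by rewrite eqxx subrK.
Qed.

Lemma y_mapK : cancel y_map yinv_map.
Proof.
move=> e; apply: lift_end_inj; move: (end_valP e) => /=.
case: (end_val e) => [[N []] u] uP /=; have := uP 0; rewrite /letter_bound /=.
  by rewrite addrK.
case: eqP => [u0 _|u0 /andP[gt0 _]] /=; first by rewrite scons_stail.
rewrite ifF; last by apply/eqP; lia.
by rewrite stail_scons scons_stail //; lia.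
Qed.

Lemma yinv_mapK : cancel yinv_map y_map.
Proof.
move=> e; apply: lift_end_inj; move: (end_valP e) => /=.
case: (end_val e) => [[N []] u] uP /=; have := uP 0; rewrite /letter_bound /=.
  by rewrite eqxx.
case: eqP => [u0 _|u0 /andP[gt0 ltm]] /=.
  by rewrite subrK scons_stail.
rewrite ifF; last by apply/eqP; lia.
by rewrite stail_scons scons_stail //; lia.
Qed.

(* x is the first generator and y the second one, as in Gmn. *)
Definition letter_map (l : letter) : lift_end m n -> lift_end m n :=
  match l with
  | (false, false) => x_map
  | (false, true) => xinv_map
  | (true, false) => y_map
  | (true, true) => yinv_map
  end.

Definition word_map (w : word) (e : lift_end m n) : lift_end m n :=
  foldr letter_map e w.

Definition shift_level (p : raw_end) : raw_end :=
  ((p.1.1 + 1)%R, p.1.2, p.2).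

Lemma iter_x_raw k (N : int) (u : nat -> nat) : u 0 + k < m ->
  iter k (x_raw m) (N, true, u) = (N, true, scons (u 0 + k) (stail u)).
Proof.
elim: k => [_|k IHk ltk] /=; first by rewrite addn0 scons_stail.
rewrite IHk /=; last by lia.
by rewrite ifF; [rewrite -addnA addn1 | apply/eqP; lia].
Qed.

Lemma iter_y_raw k (N : int) (u : nat -> nat) : u 0 + k < n ->
  iter k (y_raw n) (N, false, u) = (N, false, scons (u 0 + k) (stail u)).
Proof.
elim: k => [_|k IHk ltk] /=; first by rewrite addn0 scons_stail.
rewrite IHk /=; last by lia.
by rewrite ifF; [rewrite -addnA addn1 | apply/eqP; lia].
Qed.

Lemma iter_x_rawm p : is_end m n p -> iter m (x_raw m) p = shift_level p.
Proof.
move=> pP; have /andP[m1 n1] := end_gt1 pP.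
case: p pP => [[N []] u] uP; have := uP 0; rewrite /letter_bound /= => u0.
  have -> : m = (u 0 - 1) + (1 + (1 + (m - 1 - u 0))) by lia.
  rewrite !iterD.
  have -> : u 0 - 1 + (1 + (1 + (m - 1 - u 0))) = m by lia.
  rewrite iter_x_raw /=; last by lia.
  rewrite ifT; last by apply/eqP; lia.
  rewrite iter_x_raw /=; last by lia.
  by rewrite !stail_scons scons_stail //; lia.
have -> : m = 1 + ((m - 2) + 1) by lia.
rewrite !iterD; have -> : 1 + (m - 2 + 1) = m by lia.
by rewrite /= iter_x_raw /= ?ifT //=; [apply/eqP | ]; lia.
Qed.

Lemma iter_y_rawn p : is_end m n p -> iter n (y_raw n) p = shift_level p.
Proof.
move=> pP; have /andP[m1 n1] := end_gt1 pP.
case: p pP => [[N []] u] uP; have := uP 0; rewrite /letter_bound /= => u0.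
  have -> : n = 1 + ((n - 2) + 1) by lia.
  rewrite !iterD; have -> : 1 + (n - 2 + 1) = n by lia.
  by rewrite /= iter_y_raw /= ?ifT //=; [apply/eqP | ]; lia.
have -> : n = (u 0 - 1) + (1 + (1 + (n - 1 - u 0))) by lia.
rewrite !iterD.
have -> : u 0 - 1 + (1 + (1 + (n - 1 - u 0))) = n by lia.
rewrite iter_y_raw /=; last by lia.
rewrite ifT; last by apply/eqP; lia.
rewrite iter_y_raw /=; last by lia.
by rewrite !stail_scons scons_stail //; lia.
Qed.

Lemma word_map_cat (u v : word) e :
  word_map (u ++ v) e = word_map u (word_map v e).
Proof. exact: foldr_cat. Qed.

Lemma word_map_nseq k l e : word_map (nseq k l) e = iter k (letter_map l) e.
Proof. by elim: k => //= k ->. Qed.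

Lemma letter_mapK l : cancel (letter_map (linv l)) (letter_map l).
Proof.
by case: l => [[] []];
  [exact: y_mapK | exact: yinv_mapK | exact: x_mapK | exact: xinv_mapK].
Qed.

Lemma word_map_weq (u v : word) : weq m n u v -> word_map u =1 word_map v.
Proof.
elim=> {u v} [u|u v _ IH|u v w _ IHuv _ IHvw|u l v|u v] e //.
- by rewrite IHuv IHvw.
- by rewrite !word_map_cat /= letter_mapK.
rewrite !word_map_cat !word_map_nseq; congr word_map.
apply: lift_end_inj; set e' := word_map v e.
have valx k : end_val (iter k x_map e') = iter k (x_raw m) e'.
  by elim: k => //= k ->.
have valy k : end_val (iter k y_map e') = iter k (y_raw n) e'.
  by elim: k => //= k ->.
rewrite valx valy iter_x_rawm ?iter_y_rawn //; exact: end_valP.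
Qed.

(* Left action of Gmn on the lifted ends: it does not depend on the chosen
   word, see act_pi. *)
Definition act (g : Gmn m n) (e : lift_end m n) : lift_end m n :=
  word_map (repr g) e.

Lemma act_pi (w : word) e : act (\pi_(Gmn m n) w) e = word_map w e.
Proof. exact: word_map_weq (weq_repr m n w) e. Qed.

Lemma act_gx e : act (gx m n) e = x_map e.
Proof. exact: act_pi. Qed.

Lemma act_gy e : act (gy m n) e = y_map e.
Proof. exact: act_pi. Qed.

Lemma act1 e : act 1%g e = e.
Proof. exact: act_pi. Qed.

Lemma actM (g h : Gmn m n) e : act (g * h)%g e = act g (act h e).
Proof. by rewrite act_pi word_map_cat. Qed.

(* lexicographic, with - < + *)
Definition end_lt (e e' : lift_end m n) : Prop :=
  let: (N, eps, u) := end_val e in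
  let: (N', eps', u') := end_val e' in
  (N < N')%R \/
  (N = N' /\
   (~~ eps && eps' \/
    (eps = eps' /\ exists2 k, forall j, j < k -> u j = u' j & u k < u' k))).

Definition pair_lt (E F : lift_end m n) (g h : Gmn m n) : Prop :=
  end_lt (act g E) (act h E) \/
  (act g E = act h E /\ end_lt (act g F) (act h F)).

End Action.

Lemma ones_endP (m n : nat) (n2 : 2 <= n) (nm : n <= m) (N : int) (eps : bool) :
  is_end m n (N, eps, fun=> 1).
Proof.
by move=> j; rewrite /= /letter_bound; case: ifP => _ //; exact: leq_trans nm.
Qed.

Definition ones_end (m n : nat) (n2 : 2 <= n) (nm : n <= m)
    (N : int) (eps : bool) : lift_end m n :=
  LiftEnd (ones_endP n2 nm N eps).

(* Main.v *)
Require Import Defs.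
From mathcomp Require Import all_boot all_order all_algebra.
From mathcomp Require Import boolp zify.

(** Write z for the central element x^m = y^n. Applying the generators gives
    - s2 E = E, s1 E = F > E and, since (m, n) is not (2, 2), s2 F > F.
    Hence a word in s1, s2 and s2^-1 never moves E down, and moves it up as soon
    as it contains s1 ([act_word_E]), while a positive power of s2 fixes E and
    moves F up ([s2X_F]). So every element that is positive for the
    Dehornoy-like ordering is positive for the ordering defined by E and F.

    For the converse, every g is explicitly recovered, up to a power of s2 on
    the right, from the point g E ([all_coded]): if g E is
    (N; eps l1 l2 ... lk 1 1 ...) then g is z^N times a product of the x^l
    and of the z^-1 y^l, alternately, times a power of s2. If moreover
    g E >= E, then N >= 0, and the identities
    - x = s1 s2, y = s2^-1 x^(m-1), z^-1 y x = s2^-1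
    turn this product into a word in s1, s2, s2^-1 ([nonneg_of_le]). If the word
    contains s1, then g is positive; otherwise g is a power of s2, and its sign
    is detected by its action on F ([pair_lt1P]).

    The same dichotomy shows that only the identity fixes both E and F
    ([act_EF_inj]), which gives totality of the ordering defined by E and F; the
    other axioms of a left ordering follow from the fact that the action
    preserves the total order on the lifted ends ([act_lt]). *)

Set Implicit Arguments.
Unset Strict Implicit.
Unset Printing Implicit Defensive.

Local Open Scope quotient_scope.

(** * Lexicographic order on the lifted ends *)

Definition seq_lt (u v : nat -> nat) : Prop :=
  exists2 k, forall j, j < k -> u j = v j & u k < v k.

Lemma seq_ltE u v :
  seq_lt u v <-> u 0 < v 0 \/ (u 0 = v 0 /\ seq_lt (stail u) (stail v)).
Proof.
split=> [[[|k] eqk ltk]|[lt0|[eq0 [k eqk ltk]]]].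
- by left.
- by right; split; [exact: eqk | exists k => // j jk; exact: eqk].
- by exists 0.
- by exists k.+1 => // -[|j] // jk; exact: eqk.
Qed.

Lemma seq_lt_scons a b u v :
  seq_lt (scons a u) (scons b v) <-> a < b \/ (a = b /\ seq_lt u v).
Proof. exact: seq_ltE. Qed.

Lemma seq_lt_trans u v w : seq_lt u v -> seq_lt v w -> seq_lt u w.
Proof.
move=> [k eqk ltk] [l eql ltl]; exists (minn k l) => [j|].
  by rewrite leq_min => /andP[jk jl]; rewrite eqk ?eql.
case: (ltngtP k l) => [kl|lk|kl]; first by rewrite -eql.
  by rewrite eqk.
by apply: ltn_trans ltk _; rewrite kl.
Qed.

Lemma seq_lt_total u v : [\/ seq_lt u v, u = v | seq_lt v u].
Proof.
have [[j uvj]|eq] := pselect (exists j, u j != v j); last first.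
  apply: Or32; apply/funext => j; apply/eqP/negPn/negP => uvj.
  by apply: eq; exists j.
have exj : exists j, u j != v j by exists j.
case: (ex_minnP exj) => k uvk mink.
have eqk i : i < k -> u i = v i.
  by move=> ik; apply/eqP; apply: contraLR ik => /mink; rewrite -leqNgt.
case: (ltngtP (u k) (v k)) uvk => // lt _; first by apply: Or31; exists k.
by apply: Or33; exists k => // i /eqk.
Qed.

Definition raw_lt (p q : raw_end) : Prop :=
  let: (N, eps, u) := p in
  let: (N', eps', u') := q in
  (N < N')%R \/
  (N = N' /\ (~~ eps && eps' \/ (eps = eps' /\ seq_lt u u'))).

Lemma raw_lt_irr p : ~ raw_lt p p.
Proof.
case: p => [[N eps] u] [|[_ [|[_ [k _]]]]]; first by lia.
  by case: eps.
by rewrite ltnn.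
Qed.

Lemma raw_lt_trans p q r : raw_lt p q -> raw_lt q r -> raw_lt p r.
Proof.
case: p q r => [[N1 e1] u1] [[N2 e2] u2] [[N3 e3] u3] /=.
move=> [lt12|[-> h12]] [lt23|[<- h23]].
- by left; lia.
- by left.
- by left.
right; split=> //; case: h12 => [/andP[e1N e2P]|[-> lt12]].
  by left; rewrite e1N; case: h23 => [/andP[]|[<-]] //; rewrite e2P.
case: h23 => [|[-> lt23]]; [by left | right; split=> //].
exact: seq_lt_trans lt12 lt23.
Qed.

Lemma raw_lt_total p q : [\/ raw_lt p q, p = q | raw_lt q p].
Proof.
case: p q => [[N e] u] [[N' e'] u'] /=.
have [lt|[lt|<-]] : (N < N')%R \/ (N' < N)%R \/ N = N' by lia.
- by apply: Or31; left.
- by apply: Or33; left.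
have same_sign : forall eps, [\/ raw_lt (N, eps, u) (N, eps, u'),
    (N, eps, u) = (N, eps, u') | raw_lt (N, eps, u') (N, eps, u)].
  move=> eps; case: (seq_lt_total u u') => [lt|->|lt].
  - by apply: Or31; right; split=> //; right.
  - by apply: Or32.
  - by apply: Or33; right; split=> //; right.
case: e e' => [] [].
- exact: same_sign.
- by apply: Or33; right; split=> //; left.
- by apply: Or31; right; split=> //; left.
- exact: same_sign.
Qed.

(** * Words without a negative first letter *)

Section Nonneg.
Variables (G : groupType) (a b : G).
Implicit Types g h : G.

Local Open Scope group_scope.

(** The submonoid generated by [a], [b] and [b^-1]: besides the positive
    elements it contains the powers of [b], so that it is closed under product
    and can be proved to contain an element factor by factor. *)
Definition nonneg g :=
  exists2 w : word, (false, true) \notin w & eval a b w = g.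

Lemma nonneg1 : nonneg 1.
Proof. by exists [::]. Qed.

Lemma eval_cat u v : eval a b (u ++ v) = eval a b u * eval a b v.
Proof. by elim: u => [|l u IHu] /=; rewrite ?mul1g // IHu mulgA. Qed.

Lemma nonnegM g h : nonneg g -> nonneg h -> nonneg (g * h).
Proof.
move=> [u uN <-] [v vN <-]; exists (u ++ v); last exact: eval_cat.
by rewrite mem_cat negb_or uN.
Qed.

Lemma nonnegX g k : nonneg g -> nonneg (g ^+ k).
Proof.
move=> gN; elim: k => [|k IHk]; first exact: nonneg1.
by rewrite expgS; exact: nonnegM.
Qed.

Lemma nonneg_fst : nonneg a.
Proof. by exists [:: lx] => //=; rewrite mulg1. Qed.

Lemma nonneg_snd : nonneg b.
Proof. by exists [:: ly] => //=; rewrite mulg1. Qed.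

Lemma nonneg_sndV : nonneg b^-1.
Proof. by exists [:: linv ly] => //=; rewrite mulg1. Qed.

Lemma eval_snd_power w : (false, true) \notin w -> (false, false) \notin w ->
  exists k, eval a b w = b ^+ k \/ eval a b w = b ^- k.
Proof.
elim: w => [|[[] e] w IHw]; first by exists 0; left.
  rewrite !inE /= => /IHw{}IHw /IHw[k]; rewrite /eval_letter /=.
  case: e k => [] [|k] [] ->.
  - by exists 1%N; right; rewrite mulg1 expg1.
  - by exists 1%N; right; rewrite invg1 mulg1 expg1.
  - by exists k; left; rewrite expgS mulKg.
  - by exists k.+2; right; rewrite -invgM -expgSr.
  - by exists 1%N; left; rewrite mulg1 expg1.
  - by exists 1%N; left; rewrite invg1 mulg1 expg1.
  - by exists k.+2; left; rewrite -expgS.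
  - by exists k; right; rewrite expgSr invgM mulVKg.
by rewrite !inE /=; case: e.
Qed.

Lemma nonneg_cases g : nonneg g ->
  dehornoy_positive a b g \/ exists k, g = b ^- k.
Proof.
move=> [w wV <-].
have [w1|w1] := boolP ((false, false) \in w); first by left; left; exists w.
have [[|k] [->|->]] := eval_snd_power wV w1.
- by right; exists 0; rewrite invg1.
- by right; exists 0.
- by left; right; exists k.+1.
- by right; exists k.+1.
Qed.

End Nonneg.

(** * Order-preserving action on the lifted ends *)

Section Action.
Variables m n : nat.
Implicit Types (g h : Gmn m n) (e : lift_end m n).

Local Notation x := (gx m n).
Local Notation y := (gy m n).
Local Notation a := (s1 m n).
Local Notation b := (s2 m n).

(** Tails are never modified, so only the level, the sign and the first letter
    matter: the letter 1 put in front of a point of sign - is below every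
    [l + 1] with [l] a letter, and the wrap-around at [m - 1] lands in the sign -
    of the next level, above all points of the current one. *)
Lemma x_raw_lt p q : is_end m n p -> is_end m n q ->
  raw_lt p q -> raw_lt (x_raw m p) (x_raw m q).
Proof.
case: p q => [[N e] u] [[N' e'] u'] uP u'P /=.
have := uP 0; have := u'P 0; rewrite /letter_bound /=.
move=> {uP u'P} u'b ub [ltN|[<-{N'} [/andP[eN e'P]|[ee' ltu]]]].
- have [lt1|<-] : (N + 1 < N')%R \/ (N + 1 = N')%R by lia.
    by case: e {ub}; case: e' {u'b} => /=;
      do ?[case: eqP => _]; left; lia.
  case: e ub => ub; case: e' u'b => u'b; do ?[case: eqP => ?];
    try (by left; lia); right; split=> //; by left.
- case: e eN ub => // _ ub; case: e' e'P u'b => // _ u'b.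
  case: eqP => ?; first by left; lia.
  by right; split=> //; right; split=> //; apply/seq_lt_scons; left; lia.
move/seq_ltE: ltu => ltu; case: e' / ee' u'b => u'b.
case: e ub u'b => /= ub u'b; last first.
  right; split=> //; right; split=> //; apply/seq_lt_scons.
  by right; split=> //; apply/seq_ltE.
case: eqP => um; case: eqP => u'm.
- right; split=> //; right; split=> //.
  by case: ltu => [|[]] //; lia.
- by case: ltu => [|[]]; lia.
- by left; lia.
right; split=> //; right; split=> //; apply/seq_lt_scons.
by case: ltu => [|[-> ltu]]; [left; lia | right].
Qed.

Lemma y_raw_lt p q : is_end m n p -> is_end m n q ->
  raw_lt p q -> raw_lt (y_raw n p) (y_raw n q).
Proof.
case: p q => [[N e] u] [[N' e'] u'] uP u'P /=.
have := uP 0; have := u'P 0; rewrite /letter_bound /=.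
move=> {uP u'P} u'b ub [ltN|[<-{N'} [/andP[eN e'P]|[ee' ltu]]]].
- have [lt1|<-] : (N + 1 < N')%R \/ (N + 1 = N')%R by lia.
    by case: e {ub}; case: e' {u'b} => /=;
      do ?[case: eqP => _]; left; lia.
  case: e ub => ub; case: e' u'b => u'b; do ?[case: eqP => ?];
    try (by left; lia); right; split=> //; try (by left).
  by right; split=> //; apply/seq_lt_scons; left; lia.
- case: e eN ub => // _ ub; case: e' e'P u'b => // _ u'b.
  by case: eqP => ?; left; lia.
move/seq_ltE: ltu => ltu; case: e' / ee' u'b => u'b.
case: e ub u'b => /= ub u'b.
  right; split=> //; right; split=> //; apply/seq_lt_scons.
  by right; split=> //; apply/seq_ltE.
case: eqP => um; case: eqP => u'm.
- right; split=> //; right; split=> //.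
  by case: ltu => [|[]] //; lia.
- by case: ltu => [|[]]; lia.
- by right; split=> //; left.
right; split=> //; right; split=> //; apply/seq_lt_scons.
by case: ltu => [|[-> ltu]]; [left; lia | right].
Qed.

Lemma end_lt_irr e : ~ end_lt e e.
Proof. exact: raw_lt_irr. Qed.

Lemma end_lt_trans e1 e2 e3 : end_lt e1 e2 -> end_lt e2 e3 -> end_lt e1 e3.
Proof. exact: raw_lt_trans. Qed.

Lemma end_lt_total e e' : [\/ end_lt e e', e = e' | end_lt e' e].
Proof.
case: (raw_lt_total e e') => [||]; [exact: Or31 | | exact: Or33].
by move/lift_end_inj; exact: Or32.
Qed.

Lemma Gmn_pi_cons (l : letter) (w : word) :
  \pi_(Gmn m n) (l :: w) = (\pi_(Gmn m n) [:: l] * \pi_(Gmn m n) w)%g.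
Proof.
apply/esym/pi_weq; apply: (@weq_cat m n _ [:: l] _ w); exact: weq_repr.
Qed.

Lemma Gmn_pi_inv (l : letter) :
  \pi_(Gmn m n) [:: linv l] = (\pi_(Gmn m n) [:: l])^-1%g.
Proof.
apply/esym/mulg1_eq; rewrite -Gmn_pi_cons; apply: pi_weq.
exact: (weq_cancel m n [::] l [::]).
Qed.

Lemma Gmn_ind (P : Gmn m n -> Prop) :
  P 1%g ->
  (forall g, P g -> P (x * g)%g) -> (forall g, P g -> P (x^-1 * g)%g) ->
  (forall g, P g -> P (y * g)%g) -> (forall g, P g -> P (y^-1 * g)%g) ->
  forall g, P g.
Proof.
move=> P1 Px PxV Py PyV g; rewrite -[g]reprK.
elim: (repr g) => [|[[] []] w IHw]; first exact: P1; rewrite Gmn_pi_cons.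
- by rewrite (Gmn_pi_inv ly); exact: PyV.
- exact: Py.
- by rewrite (Gmn_pi_inv lx); exact: PxV.
- exact: Px.
Qed.

Lemma actK g e : act g^-1%g (act g e) = e.
Proof. by rewrite -actM mulVg act1. Qed.

Lemma actVK g e : act g (act g^-1%g e) = e.
Proof. by rewrite -actM mulgV act1. Qed.

(** Only the generators need a case analysis on the formulas: the inverse of an
    increasing bijection of a total order is increasing. *)
Lemma act_lt g e e' : end_lt e e' -> end_lt (act g e) (act g e').
Proof.
have mono_inv h : (forall e e', end_lt e e' -> end_lt (act h e) (act h e')) ->
    forall e e', end_lt e e' -> end_lt (act h^-1%g e) (act h^-1%g e').
  move=> mono e1 e2 lt12.
  case: (end_lt_total (act h^-1%g e1) (act h^-1%g e2)) => // [eq12|/mono].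
    by case: (@end_lt_irr e1); rewrite -{2}(actVK h e1) eq12 actVK.
  by rewrite !actVK => /(end_lt_trans lt12)/end_lt_irr.
have monox e1 e2 : end_lt e1 e2 -> end_lt (act x e1) (act x e2).
  by rewrite !act_gx; apply: x_raw_lt; exact: end_valP.
have monoy e1 e2 : end_lt e1 e2 -> end_lt (act y e1) (act y e2).
  by rewrite !act_gy; apply: y_raw_lt; exact: end_valP.
elim/Gmn_ind: g e e' => [|g IHg|g IHg|g IHg|g IHg] e e' lt.
- by rewrite !act1.
- by rewrite !actM; apply: monox; exact: IHg.
- by rewrite !actM; apply: mono_inv; [exact: monox | exact: IHg].
- by rewrite !actM; apply: monoy; exact: IHg.
- by rewrite !actM; apply: mono_inv; [exact: monoy | exact: IHg].
Qed.

Lemma act_ltE g e e' : end_lt (act g e) (act g e') <-> end_lt e e'.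
Proof.
split; last exact: act_lt.
by move=> /(act_lt g^-1%g); rewrite !actK.
Qed.

(** * The central element [x ^+ m] *)

Lemma gxm_gyn : (x ^+ m = y ^+ n)%g.
Proof.
have pi_nseq l k : (\pi_(Gmn m n) [:: l] ^+ k)%g = \pi_(Gmn m n) (nseq k l).
  by elim: k => [|k IHk] //; rewrite expgS IHk -Gmn_pi_cons.
rewrite /gx /gy !pi_nseq; apply: pi_weq.
by have := weq_rel m n [::] [::]; rewrite /= !cats0.
Qed.

Lemma gxm_central g : (x ^+ m * g = g * x ^+ m)%g.
Proof.
have cx : commute (x ^+ m)%g x by apply/commute_sym/commuteX.
have cy : commute (x ^+ m)%g y by rewrite gxm_gyn; apply/commute_sym/commuteX.
elim/Gmn_ind: g => [|g IHg|g IHg|g IHg|g IHg]; first exact: commute1.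
- exact: commuteM.
- by apply: commuteM => //; exact: commuteV.
- exact: commuteM.
- by apply: commuteM => //; exact: commuteV.
Qed.

Lemma gxmV_central g : (x ^- m * g = g * x ^- m)%g.
Proof.
by apply/esym/commuteV/esym/gxm_central.
Qed.

Lemma end_val_actX k e : end_val (act (x ^+ k)%g e) = iter k (x_raw m) e.
Proof. by elim: k => [|k IHk]; rewrite ?act1 // expgS actM act_gx /= IHk. Qed.

Lemma act_gxm e : end_val (act (x ^+ m)%g e) = shift_level e.
Proof. by rewrite end_val_actX (iter_x_rawm (end_valP e)). Qed.

Lemma act_gxmV e :
  end_val (act (x ^- m)%g e) =
    (((end_val e).1.1 - 1)%R, (end_val e).1.2, (end_val e).2).
Proof.
have := act_gxm (act (x ^- m)%g e); rewrite actVK.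
case: (end_val (act _ e)) => [[N eps] u] -> /=.
by rewrite GRing.addrK.
Qed.

Lemma act_gyV e : act y^-1%g e = yinv_map e.
Proof. by rewrite -{1}[e]yinv_mapK -act_gy actK. Qed.

(** * Normal form of an element and the image of [E] *)

Hypotheses (n2 : 2 <= n) (nm : n <= m).

Lemma s1s2 : (a * b = x)%g.
Proof.
by rewrite /s1 /s2 !mulgA mulgVK mulgK.
Qed.

Lemma nonneg_gx : nonneg a b x.
Proof.
by rewrite -s1s2; apply: nonnegM; [exact: nonneg_fst | exact: nonneg_snd].
Qed.

Lemma nonneg_gy : nonneg a b y.
Proof.
have -> : y = (b^-1 * x ^+ (m - 1))%g by rewrite /s2 invgM invgK mulgVK.
apply: nonnegM (nonneg_sndV _ _) _; exact: nonnegX nonneg_gx.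
Qed.

Lemma s2V : (b^-1 = x ^- m * y * x)%g.
Proof.
rewrite gxmV_central /s2 invgM invgK -mulgA; congr (_ * _)%g.
have -> : (x ^+ m = x * x ^+ (m - 1))%g.
  by rewrite -expgS; congr (_ ^+ _)%g; lia.
by rewrite invgM mulgVK.
Qed.

(** An element that sends [E] to [(0; eps L 1 1 1 ...)]. Indeed, when [l] is an
    admissible letter, [x ^+ l] sends [(0; - u)] to [(0; + l u)] and
    [x ^- m * y ^+ l] sends [(0; + u)] to [(0; - l u)]; as for the empty list,
    [x] sends [E] to [F]. *)
Fixpoint path_elt (eps : bool) (L : seq nat) : Gmn m n :=
  match L with
  | [::] => if eps then x else 1%g
  | l :: L' =>
    ((if eps then x ^+ l else x ^- m * y ^+ l) * path_elt (~~ eps) L')%g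
  end.

Definition endseq (L : seq nat) : nat -> nat := foldr scons (fun=> 1) L.

(** In [path_elt eps L] the factors [x ^- m] are the only ones outside the
    monoid generated by [s1], [s2] and [s2^-1]. Letters are at least 1, so each
    of them is followed by a [y], and then by an [x] (coming from the empty list
    if there is no further letter). As [x ^- m] is central, it can be moved to
    the last [y] before that [x], and [x ^- m * y * x] is [s2^-1]. The second
    conjunct is the state of the induction between that [y] and that [x]. *)
Lemma nonneg_path_aux L : (forall j, 0 < endseq L j) ->
  nonneg a b (path_elt false L) /\ nonneg a b (x ^- m * y * path_elt true L)%g.
Proof.
elim: L => [|l L IHL] Lpos /=.
  by split; [exact: nonneg1 | rewrite -s2V; exact: nonneg_sndV].
have [IH1 IH2] := IHL (fun j => Lpos j.+1).
have {}Lpos : 0 < l := Lpos 0.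
rewrite -(prednK Lpos); split.
  rewrite gxmV_central expgSr -!mulgA.
  apply: nonnegM; first exact: nonnegX nonneg_gy.
  by rewrite !mulgA -gxmV_central.
rewrite expgS !mulgA -s2V; apply: nonnegM => //.
by apply: nonnegM; [exact: nonneg_sndV | exact: nonnegX nonneg_gx].
Qed.

Lemma nonneg_path eps L :
  (forall j, 0 < endseq L j) -> nonneg a b (path_elt eps L).
Proof.
move=> Lpos; case: eps; last by case: (nonneg_path_aux Lpos).
case: L Lpos => [|l L] Lpos /=; first exact: nonneg_gx.
apply: nonnegM; first exact: nonnegX nonneg_gx.
by case: (@nonneg_path_aux L) => // j; exact: (Lpos j.+1).
Qed.

Local Notation E := (ones_end n2 nm 0%R false).
Local Notation F := (ones_end n2 nm 0%R true).

(** A normal form of [g] whose first factors can be read off the point [g E].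
    The power of the central element [x ^+ m], which is the integer coordinate
    of the point, is split as a difference [j - i] of natural numbers. *)
Definition coded_by g (i j k : nat) (eps : bool) (L : seq nat) : Prop :=
  ((x ^+ m) ^+ i * g = (x ^+ m) ^+ j * (path_elt eps L * b ^+ k))%g /\
  end_val (act g E) = ((j%:Z - i%:Z)%R, eps, endseq L).

Definition coded g := exists i j k eps L, coded_by g i j k eps L.

(** The empty list and [[:: 1]] denote the same end. The elements attached to
    them agree for the sign +, and differ by the factor [s2], which fixes [E],
    for the sign -. Hence the list can be assumed to have a first letter, on
    which the generators act. *)
Lemma coded_cons g : coded g ->
  exists i j k eps l L, coded_by g i j k eps (l :: L).
Proof.
move=> [i [j [k [eps [[|l L] [eqg actg]]]]]]; last by exists i, j, k, eps, l, L.
have ones : endseq [::] = endseq [:: 1] by apply/funext => -[].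
case: eps eqg actg => eqg actg.
  exists i, j, k, true, 1, [::]; split; last by rewrite actg ones.
  by rewrite eqg /= expg1 mulg1.
exists i, j, k.+1, false, 1, [::]; split; last by rewrite actg ones.
by rewrite eqg /= expg1 -s2V expgS mul1g mulKg.
Qed.

Lemma gxmX_left i g h : ((x ^+ m) ^+ i * (g * h) = g * ((x ^+ m) ^+ i * h))%g.
Proof.
have comm : commute g ((x ^+ m) ^+ i)%g by apply/commuteX/esym/gxm_central.
by rewrite !mulgA comm.
Qed.

Lemma coded_gx g : coded g -> coded (x * g)%g.
Proof.
move=> /coded_cons [i [j [k [[] [l [L [eqg actg]]]]]]]; last first.
  exists i, j, k, true, [:: 1, l & L]; split.
    by rewrite gxmX_left eqg -gxmX_left /= expg1 !mulgA.
  by rewrite actM act_gx /= actg.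
have [lm|lm] := eqVneq l (m - 1).
  exists i, j.+1, k, false, L; split.
    rewrite gxmX_left eqg -gxmX_left /= expgSr -!mulgA.
    congr (_ * _)%g; rewrite !mulgA -expgS lm.
    by have -> : (m - 1).+1 = m by lia.
  rewrite actM act_gx /= actg /= lm eqxx.
  by congr (_, _, _); lia.
exists i, j, k, true, (l.+1 :: L); split.
  by rewrite gxmX_left eqg -gxmX_left /= expgS !mulgA.
by rewrite actM act_gx /= actg /= (negbTE lm) addn1.
Qed.

Lemma coded_gy g : coded g -> coded (y * g)%g.
Proof.
move=> /coded_cons [i [j [k [[] [l [L [eqg actg]]]]]]].
  exists i, j.+1, k, false, [:: 1, l & L]; split.
    by rewrite gxmX_left eqg -gxmX_left /= expgSr expg1 !mulgA mulgK.
  by rewrite actM act_gy /= actg /=; congr (_, _, _); lia.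
have [ln|ln] := eqVneq l (n - 1).
  exists i, j, k, true, L; split.
    rewrite gxmX_left eqg -gxmX_left /=; congr (_ * _)%g.
    rewrite !mulgA -gxmV_central -(mulgA _ y) -expgS ln.
    have -> : (n - 1).+1 = n by lia.
    by rewrite -gxm_gyn mulVg mul1g.
  by rewrite actM act_gy /= actg /= ln eqxx.
exists i, j, k, false, (l.+1 :: L); split.
  rewrite gxmX_left eqg -gxmX_left /= expgS; congr (_ * _)%g.
  by rewrite !mulgA -gxmV_central.
by rewrite actM act_gy /= actg /= (negbTE ln) addn1.
Qed.

Lemma coded_gxmV g : coded g -> coded (x ^- m * g)%g.
Proof.
move=> [i [j [k [eps [L [eqg actg]]]]]]; exists i.+1, j, k, eps, L; split.
  by rewrite expgSr mulgA mulgK.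
by rewrite actM act_gxmV actg /=; congr (_, _, _); lia.
Qed.

(** Inverses of generators come for free: [x^-1] and [y^-1] are positive words
    up to the central factor [x ^- m]. *)
Lemma all_coded g : coded g.
Proof.
have codedX c k h : (forall h, coded h -> coded (c * h)%g) ->
    coded h -> coded (c ^+ k * h)%g.
  move=> cP hP; elim: k => [|k IHk]; first by rewrite mul1g.
  by rewrite expgS -mulgA; exact: cP.
elim/Gmn_ind: g => [|g gP|g gP|g gP|g gP].
- by exists 0, 0, 0, false, [::]; split; rewrite ?act1 //= !mulg1.
- exact: coded_gx.
- have -> : (x^-1 = x ^- m * x ^+ (m - 1))%g.
    have -> : (x ^+ m = x ^+ (m - 1) * x)%g.
      by rewrite -expgSr; congr (_ ^+ _)%g; lia.
    by rewrite invgM mulgVK.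
  by rewrite -mulgA; apply: coded_gxmV; apply: codedX => //; exact: coded_gx.
- exact: coded_gy.
- have -> : (y^-1 = x ^- m * y ^+ (n - 1))%g.
    have -> : (x ^+ m = y ^+ (n - 1) * y)%g.
      by rewrite gxm_gyn -expgSr; congr (_ ^+ _)%g; lia.
    by rewrite invgM mulgVK.
  by rewrite -mulgA; apply: coded_gxmV; apply: codedX => //; exact: coded_gy.
Qed.

Definition end_le e e' := e = e' \/ end_lt e e'.

(** Every end [(0; - u)] is at or above [E], because 1 is the least letter. So
    [E <= g E] only says that the integer coordinate of [g E] is nonnegative,
    and then the normal form of [g] is a product of elements of the monoid. *)
Lemma nonneg_of_le g : end_le E (act g E) -> nonneg a b g.
Proof.
have [i [j [k [eps [L [eqg actg]]]]]] := all_coded g => leE.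
have ij : i <= j.
  case: leE => [/(congr1 (@end_val m n))|]; rewrite /end_lt actg /=.
    by case=> ?; lia.
  by case=> [|[]]; lia.
have -> : (g = (x ^+ m) ^+ (j - i) * (path_elt eps L * b ^+ k))%g.
  apply: (mulgI ((x ^+ m) ^+ i)%g); rewrite eqg !mulgA -expgnDr.
  by have -> : i + (j - i) = j by lia.
apply: nonnegM; first by do 2!apply: nonnegX; exact: nonneg_gx.
apply: nonnegM; last by apply: nonnegX; exact: nonneg_snd.
apply: nonneg_path => p; have := end_valP (act g E) p.
by rewrite actg /= => /andP[].
Qed.

(** * The points [E] and [F] under [s1] and [s2] *)

(* Both s1 and s2 factor through this preimage of E under y and x ^+ (m - 1). *)
Let E' := ones_end n2 nm (-1)%R true.

Lemma gy_E' : act y E' = E.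
Proof.
by rewrite act_gy; apply: lift_end_inj; congr (_, _, _); apply/funext => -[].
Qed.

Lemma gx_E : act x E = F.
Proof.
by rewrite act_gx; apply: lift_end_inj; congr (_, _, _); apply/funext => -[].
Qed.

Lemma gxm1_E' : act (x ^+ (m - 1))%g E' = E.
Proof.
apply: lift_end_inj; rewrite end_val_actX.
have -> : m - 1 = (m - 2).+1 by lia.
rewrite /= iter_x_raw /=; last by lia.
by rewrite ifT //; apply/eqP; lia.
Qed.

Lemma s2_E : act b E = E.
Proof. by rewrite /s2 actM -{1}gy_E' actK gxm1_E'. Qed.

Lemma s1_E : act a E = F.
Proof. by rewrite /s1 !actM -{1}gxm1_E' actK gy_E' gx_E. Qed.

Lemma ltEF : end_lt E F.
Proof. by right; split=> //; left. Qed.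

(** The image is [(0; + (m-1) (n-1) 1 1 ...)]. As [m >= n], excluding [(2, 2)]
    makes its first letter greater than 1; for [m = n = 2] the point would be
    [F]. *)
Lemma s2_F : (m, n) <> (2, 2) -> end_lt F (act b F).
Proof.
move=> mn22; have m3 : 2 < m.
  rewrite ltn_neqAle (leq_trans n2 nm) andbT; apply/eqP => m2.
  by apply: mn22; congr (_, _); lia.
rewrite /s2 actM act_gyV /end_lt end_val_actX.
have -> : m - 1 = (m - 2).+1 by lia.
rewrite iterSr iter_x_raw /=; last by lia.
right; split=> //; right; split=> //; exists 0 => //=.
by lia.
Qed.

(** The half-line at and above [E] is preserved by [s2], which fixes its
    endpoint, and moved strictly inside itself by [s1]. *)
Lemma act_word_E w : (false, true) \notin w ->
  end_le E (act (eval a b w) E) /\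
  ((false, false) \in w -> end_lt E (act (eval a b w) E)).
Proof.
elim: w => [|l w IHw] /=; first by split=> //; left; rewrite act1.
rewrite !inE negb_or actM => /andP[l1 /IHw[le lt]].
case: l l1 => [[] e2] l1 /=; last first.
  case: e2 l1 => //= _.
  have ltE : end_lt E (act a (act (eval a b w) E)).
    case: le => [<-|/(act_lt a)]; first by rewrite s1_E; exact: ltEF.
    by rewrite s1_E; exact: end_lt_trans ltEF.
  by split; [right|].
have fixE : act (if e2 then b^-1 else b)%g E = E.
  by case: (e2); rewrite -{1}s2_E ?actK ?s2_E.
have mono : end_lt E (act (eval a b w) E) ->
    end_lt E (act (if e2 then b^-1 else b)%g (act (eval a b w) E)).
  by move=> ?; rewrite -{1}fixE; apply/act_ltE.
split; last by move/lt/mono.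
by case: le => [<-|/mono]; [left; rewrite fixE | right].
Qed.

Lemma s2X_F k : (m, n) <> (2, 2) -> 0 < k -> end_lt F (act (b ^+ k)%g F).
Proof.
move=> mn22; case: k => // k _; elim: k => [|k IHk]; first exact: s2_F.
rewrite expgS actM; apply: end_lt_trans (s2_F mn22) _.
exact/act_ltE.
Qed.

Lemma s2X_E k : act (b ^+ k)%g E = E.
Proof. by elim: k => [|k IHk]; rewrite ?act1 // expgS actM IHk s2_E. Qed.

(** * Comparison of the two orderings *)

Lemma pair_lt_mul f g h : pair_lt E F g h <-> pair_lt E F (f * g)%g (f * h)%g.
Proof.
rewrite /pair_lt !actM !act_ltE.
suff -> : (act g E = act h E) <-> (act f (act g E) = act f (act h E)) by [].
by split=> [->|/(congr1 (act f^-1%g))] //; rewrite !actK.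
Qed.

Lemma positive_lt g : (m, n) <> (2, 2) ->
  dehornoy_positive a b g -> pair_lt E F 1%g g.
Proof.
move=> mn22 [[w [w1 w1V <-]]|[k k0 ->]]; rewrite /pair_lt !act1.
  by left; have [_] := act_word_E w1V; apply.
by right; rewrite s2X_E; split=> //; exact: s2X_F.
Qed.

Lemma pair_lt1P g : (m, n) <> (2, 2) ->
  pair_lt E F 1%g g <-> dehornoy_positive a b g.
Proof.
move=> mn22; split; last exact: positive_lt.
rewrite /pair_lt !act1 => lt.
have leE : end_le E (act g E) by case: lt => [|[]]; [right | left].
case: (nonneg_cases (nonneg_of_le leE)) => // -[k gE].
have bV_E : act g E = E by rewrite gE -{1}(s2X_E k) actK.
case: lt => [|[_ ltF]]; first by rewrite bV_E => /end_lt_irr.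
case: k gE => [|k] gE; first by move: ltF; rewrite gE invg1 act1 => /end_lt_irr.
have := act_lt (b ^+ k.+1)%g ltF; rewrite gE actVK.
by move/(end_lt_trans (s2X_F mn22 (ltn0Sn k)))/end_lt_irr.
Qed.

(** This is what makes the ordering total: an element that fixes [E] is
    positive, hence moves [E] or [F], or it is a power of [s2], whose nontrivial
    powers move [F]. *)
Lemma act_EF_inj g : (m, n) <> (2, 2) -> act g E = E -> act g F = F -> g = 1%g.
Proof.
move=> mn22 gE gF.
have /nonneg_of_le/nonneg_cases : end_le E (act g E) by left.
move=> [/(positive_lt mn22)|[[|k] gk]].
- by rewrite /pair_lt !act1 gE gF => -[|[_]] /end_lt_irr.
- by rewrite gk invg1.
have := s2X_F mn22 (ltn0Sn k).
by rewrite -{2}gF gk actVK => /end_lt_irr.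
Qed.

Lemma pair_lt_left_ordering : (m, n) <> (2, 2) -> left_ordering (pair_lt E F).
Proof.
move=> mn22; split.
- by move=> g [|[_]] /end_lt_irr.
- move=> f g h [ltE|[eqE ltF]] [ltE'|[eqE' ltF']].
  + by left; exact: end_lt_trans ltE ltE'.
  + by left; rewrite -eqE'.
  + by left; rewrite eqE.
  + by right; rewrite eqE eqE'; split=> //; exact: end_lt_trans ltF ltF'.
- move=> g h; case: (end_lt_total (act g E) (act h E)) => [lt|eqE|lt].
  + by apply: Or31; left.
  + case: (end_lt_total (act g F) (act h F)) => [lt|eqF|lt].
    * by apply: Or31; right.
    * apply: Or32; apply/esym; apply: (mulgI g^-1%g); rewrite mulVg.
      by apply: act_EF_inj; rewrite // actM -?eqE -?eqF actK.
    * by apply: Or33; right.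
  + by apply: Or33; left.
by move=> f g h; rewrite -pair_lt_mul.
Qed.

End Action.

Theorem theorem5 (m n : nat) (n2 : 2 <= n) (nm : n <= m)
    (mn22 : (m, n) <> (2, 2)) :
  let E : lift_end m n := ones_end n2 nm 0%R false in
  let F : lift_end m n := ones_end n2 nm 0%R true in
  left_ordering (pair_lt E F) /\
  (forall g h : Gmn m n,
      pair_lt E F g h <-> dehornoy_lt (s1 m n) (s2 m n) g h).
Proof.
move=> E F; split; first exact: pair_lt_left_ordering.
by move=> g h; rewrite (pair_lt_mul n2 nm g^-1%g) mulVg; exact: pair_lt1P.
Qed.
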